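(* Let $X$ be a finite transitive set in $\mathbb{R}^d$, regarded as the subset $X\times\{0\}$ of the hyperplane $\mathbb{R}^d\times\{0\}$ of $\mathbb{R}^{d+1}$, and let $z$ be a point in $\mathbb{R}^{d+1}$ that does not belong to this hyperplane. Then the pyramid with base $X$ and apex $z$, that is, the point set $(X\times\{0\})\cup\{z\}\subset\mathbb{R}^{d+1}$, is subtransitive. Moreover, if $X$ is subsoluble, then so is the pyramid, and hence the pyramid is Ramsey.
   Context: A finite set $W\subset\mathbb{R}^m$ is transitive if its symmetry group (the group of isometries mapping $W$ onto itself) acts transitively on $W$; it is soluble if some soluble subgroup of its symmetry group acts transitively on $W$. A finite subset of a Euclidean space is subtransitive (respectively subsoluble) if some congruent copy of it is contained in a finite transitive (respectively soluble) set in $\mathbb{R}^m$ for some $m$; the dimension $m$ may be larger than that of the space in which the original set lives. A finite subset $X$ of some Euclidean space is called Ramsey if for every positive integer $k$ there exists an $n$ such that whenever $\mathbb{R}^n$ is coloured with $k$ colours there is a monochromatic congruent copy of $X$. *)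

(* Defs.v *)
From HB Require Import structures.
From mathcomp Require Import all_boot all_order all_algebra.
From mathcomp Require Import boolp classical_sets functions cardinality reals.

Set Implicit Arguments.
Unset Strict Implicit.
Unset Printing Implicit Defensive.

Import GRing.Theory Num.Theory.

Local Open Scope classical_set_scope.
Local Open Scope ring_scope.

Section Solubility.
Local Open Scope group_scope.
Variable G : groupType.
Implicit Types H : set G.

(* MathComp's [solvable] is restricted to finite groups, whereas the symmetry
   group of a set that does not span the ambient space is infinite. *)

Definition is_subgroup H : Prop := group_closed [in H].

Definition derived_subgroup H : set G :=
  smallest is_subgroup [set [~ x, y] | x in H & y in H].

Definition soluble H : Prop :=
  exists n : nat, iter n derived_subgroup H = [set 1].

End Solubility.

(* R^m is 'rV[R]_m; the norm that MathComp-Analysis puts on matrices is the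
   sup norm, so the Euclidean distance is defined here. *)
Definition edist (R : realType) (m : nat) (x y : 'rV[R]_m) : R :=
  Num.sqrt (\sum_(i < m) (x ord0 i - y ord0 i) ^+ 2).

Record eisometry (R : realType) (m : nat) := EIsometry {
  isom_fun :> 'rV[R]_m -> 'rV[R]_m;
  isom_inv : 'rV[R]_m -> 'rV[R]_m;
  isom_funK : cancel isom_fun isom_inv;
  isom_invK : cancel isom_inv isom_fun;
  isom_dist : forall x y, edist (isom_fun x) (isom_fun y) = edist x y }.

Section IsometryGroup.
Variables (R : realType) (m : nat).
Implicit Types f g h : eisometry R m.

Lemma isometryP f g : (forall x, f x = g x) -> f = g.
Proof.
case: f g => f f' fK f'K fd [g g' gK g'K gd] /= /funext efg.
subst g; have e : f' = g' by apply/funext => x; rewrite -[in LHS](g'K x) fK.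
by subst g'; congr EIsometry; exact: Prop_irrelevance.
Qed.

Definition isom_one : eisometry R m :=
  @EIsometry R m id id (fun=> erefl) (fun=> erefl) (fun _ _ => erefl).

Lemma isom_comp_dist f g x y : edist ((f \o g) x) ((f \o g) y) = edist x y.
Proof. by rewrite /= !isom_dist. Qed.

Definition isom_mul f g : eisometry R m :=
  EIsometry (can_comp (isom_funK f) (isom_funK g))
    (can_comp (isom_invK g) (isom_invK f)) (isom_comp_dist f g).

Lemma isom_inv_dist f x y : edist (isom_inv f x) (isom_inv f y) = edist x y.
Proof. by rewrite -(isom_dist f) !isom_invK. Qed.

Definition isom_opp f : eisometry R m :=
  EIsometry (isom_invK f) (isom_funK f) (isom_inv_dist f).

Lemma isom_mulA : associative isom_mul.
Proof. by move=> f g h; exact: isometryP. Qed.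
Lemma isom_mul1 : left_id isom_one isom_mul.
Proof. by move=> f; exact: isometryP. Qed.
Lemma isom_mulr1 : right_id isom_one isom_mul.
Proof. by move=> f; exact: isometryP. Qed.
Lemma isom_mulV : left_inverse isom_one isom_opp isom_mul.
Proof. by move=> f; apply: isometryP => x; exact: isom_funK. Qed.
Lemma isom_mulrV : right_inverse isom_one isom_opp isom_mul.
Proof. by move=> f; apply: isometryP => x; exact: isom_invK. Qed.

HB.instance Definition _ := gen_eqMixin (eisometry R m).
HB.instance Definition _ := gen_choiceMixin (eisometry R m).
HB.instance Definition _ := isGroup.Build (eisometry R m)
  isom_mulA isom_mul1 isom_mulr1 isom_mulV isom_mulrV.

End IsometryGroup.

Definition symmetry_group (R : realType) (m : nat) (W : set 'rV[R]_m)
    : set (eisometry R m) :=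
  [set f : eisometry R m | f @` W = W].

Definition acts_transitively (R : realType) (m : nat)
    (H : set (eisometry R m)) (W : set 'rV[R]_m) : Prop :=
  forall x y, W x -> W y -> exists2 f, H f & f x = y.

Definition transitive_set (R : realType) (m : nat) (W : set 'rV[R]_m) : Prop :=
  finite_set W /\ acts_transitively (symmetry_group W) W.

Definition soluble_set (R : realType) (m : nat) (W : set 'rV[R]_m) : Prop :=
  finite_set W /\
  exists H : set (eisometry R m),
    [/\ is_subgroup H, H `<=` symmetry_group W, soluble H
      & acts_transitively H W].

Definition congruent (R : realType) (d m : nat)
    (X : set 'rV[R]_d) (Y : set 'rV[R]_m) : Prop :=
  exists f : 'rV[R]_d -> 'rV[R]_m,
    (forall x y, X x -> X y -> edist (f x) (f y) = edist x y) /\ f @` X = Y.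

Definition subtransitive (R : realType) (d : nat) (X : set 'rV[R]_d) : Prop :=
  exists (m : nat) (W Y : set 'rV[R]_m),
    [/\ transitive_set W, congruent X Y & Y `<=` W].

Definition subsoluble (R : realType) (d : nat) (X : set 'rV[R]_d) : Prop :=
  exists (m : nat) (W Y : set 'rV[R]_m),
    [/\ soluble_set W, congruent X Y & Y `<=` W].

Definition monochromatic (R : realType) (n k : nat)
    (c : 'rV[R]_n -> 'I_k) (Y : set 'rV[R]_n) : Prop :=
  exists a : 'I_k, forall y, Y y -> c y = a.

Definition ramsey (R : realType) (d : nat) (X : set 'rV[R]_d) : Prop :=
  forall k : nat, (0 < k)%N -> exists n : nat,
    forall c : 'rV[R]_n -> 'I_k,
      exists2 Y : set 'rV[R]_n, congruent X Y & monochromatic c Y.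

Definition base_embed (R : realType) (d : nat) (x : 'rV[R]_d) : 'rV[R]_(d + 1) :=
  row_mx x 0.

Definition base_hyperplane (R : realType) (d : nat) : set 'rV[R]_(d + 1) :=
  range (@base_embed R d).

Definition pyramid (R : realType) (d : nat) (X : set 'rV[R]_d)
    (z : 'rV[R]_(d + 1)) : set 'rV[R]_(d + 1) :=
  (@base_embed R d @` X) `|` [set z].

(* Main.v *)
Require Import Defs.
From mathcomp Require Import all_boot all_order all_algebra all_fingroup.
From mathcomp Require Import cyclic nilpotent maximal commutator.
From mathcomp Require Import boolp classical_sets functions cardinality reals.
From mathcomp Require Import ring.

Set Implicit Arguments.
Unset Strict Implicit.
Unset Printing Implicit Defensive.

Import Order.TTheory GRing.Theory Num.Theory.

(** Let [W] be a finite set containing a copy of [X], acted upon transitively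
    by a group [H] of symmetries, let [p] be the foot of the perpendicular from
    the apex [z] to the affine hull of [X] and [h > 0] the length of that
    perpendicular.

    The pyramid embeds in a transitive set.  The wreath product of [H] with a
    cyclic group acts on tuples of points, by elements of [H] on each entry and
    by rotations of the tuple.  The orbit of a tuple [(q_0, ..., q_n)] with
    [q_0] in [W] contains the copy [(x, q_1, ..., q_n)] of [W] and also the
    rotated tuple [(q_n, q_0, ..., q_(n-1))].  When the [q_i] walk from [q_0] to
    [p] in [n] equal steps, the squared distance from the former to the latter
    is [|x - p|^2 + |p - q_0|^2 / n]: the apex sits above [p], at a height that
    can be made as small as desired.  One more coordinate, which grows linearly
    along the walk, raises this height to exactly [h] (lemma
    [pyramid_in_orbit]).  The orbit is finite because [p] is an affine
    combination of points of [W], and such combinations are preserved by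
    isometries.  The wreath product is soluble when [H] is
    ([wreath_group_soluble]).

    A subset of a soluble set is Ramsey (Kriz's theorem, [soluble_ramsey]).
    Let [T] be a finite soluble set, and colour the words over [T], seen as
    points of a power of the ambient space.  By Ramsey's theorem for [M]-element
    sets, if a letter [y] is used as a filler and a short word is written on
    well chosen positions, then the colour of the result depends only on the
    word obtained by deleting [y].  Let [a] be a symmetry of [T] of order [q].
    Replacing each letter [x] of a word by the block [x, a x, ..., a^(q-1) x]
    multiplies squared distances by [q], and the blocks of [y] and of [a y] are
    rotations of each other that agree once [y] is deleted.  Hence, on a copy
    enlarged by a factor that does not depend on the colouring, [y] and [a y]
    are interchangeable.  Repeating this argument makes interchangeable
    all letters of an orbit of [a] ([homogenizable_merge_iterates]), then, by
    induction along a chain of subgroups with cyclic quotients, all letters of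
    an orbit of a soluble group ([homogenizable_solvable]).  Transitivity then
    gives a monochromatic copy of [T]. *)

(** * Ramsey's theorem for sets of a given size *)

Lemma pigeonhole_seq (I : eqType) (C : finType) (L : nat) (A : seq I)
    (h : I -> C) : #|C| * L < size A ->
  exists col, L < size [seq i <- A | h i == col].
Proof.
move=> ltA; apply/existsP; apply: contraLR ltA => /existsPn no.
rewrite -leqNgt -sum1_size (partition_big h xpredT) //= -sum_nat_const.
by apply: leq_sum => col _; rewrite sum1_count -size_filter leqNgt.
Qed.

(** Encoding an [M]-element set as a subsequence lets the induction on [M] peel
    off first elements: [pre] produces a sequence in which the colour of a
    subsequence of length [M.+1] depends only on its first element, and the
    pigeonhole principle then makes that colour constant. *)
Lemma ramsey_subseq (C : finType) (M L : nat) :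
  exists n, forall (A : seq nat) (g : seq nat -> C), uniq A -> n <= size A ->
  exists Q col, [/\ subseq Q A, size Q = L &
    forall P, subseq P Q -> size P = M -> g P = col].
Proof.
elim: M L => [|M IH] L.
  exists L => A g _ leL; exists (take L A), (g [::]); split.
  - exact: take_subseq.
  - by rewrite size_takel.
  - by move=> P _ /size0nil->.
have pre t : exists n, forall (A : seq nat) (g : seq nat -> C),
    uniq A -> n <= size A ->
    exists Q (h : nat -> C), [/\ subseq Q A, size Q = t &
      forall x P, subseq (x :: P) Q -> size P = M -> g (x :: P) = h x].
  elim: t => [|t [n Hn]].
    exists 0 => A g _ _; exists [::], (fun=> g [::]); split=> //; exact: sub0seq.
  have [n' Hn'] := IH n.
  exists n'.+1 => -[//|x A] g /= /andP[xA uA] leA.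
  have [Q [col [QA sQ HQ]]] := Hn' A (fun P => g (x :: P)) uA leA.
  have [||Q' [h [Q'Q sQ' HQ']]] := Hn Q g; rewrite ?sQ ?(subseq_uniq QA) //.
  have xQ' : x \notin Q'.
    by apply: contra xA => /(mem_subseq Q'Q)/(mem_subseq QA).
  exists (x :: Q'), (fun y => if y == x then col else h y); split.
  - by rewrite /= eqxx (subseq_trans Q'Q).
  - by rewrite /= sQ'.
  move=> y P /=; case: eqVneq => [->|nyx] sub sP; last exact: HQ'.
  by apply: HQ => //; apply: subseq_trans sub Q'Q.
have [n Hn] := pre (#|C| * L).+1.
exists n => A g uA leA; have [Q [h [QA sQ HQ]]] := Hn A g uA leA.
have [|col Hcol] := @pigeonhole_seq _ _ L Q h; first by rewrite sQ.
set Q' := filter _ _ in Hcol; exists (take L Q'), col.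
have sub : subseq (take L Q') Q' by apply: take_subseq.
split.
- by rewrite (subseq_trans sub) // (subseq_trans _ QA) // filter_subseq.
- by rewrite size_takel // ltnW.
case=> [//|x P] sP [sizeP].
have {}sP := subseq_trans sP sub.
rewrite HQ ?(subseq_trans sP) ?filter_subseq //.
have := mem_subseq sP (mem_head x P).
by rewrite mem_filter => /andP[/eqP].
Qed.

(** * Colourings of words that ignore some letters *)

Section Words.
Variables (T : finType) (V : nmodType) (D : T -> T -> V).
Hypothesis D0 : forall x, D x x = 0%R.
Implicit Types (u v w z : seq T) (kap : T -> nat) (P : seq nat).
Local Open Scope ring_scope.

Definition wdist u v : V := \sum_(p <- zip u v) D p.1 p.2.

Lemma wdistE y u v : size u = size v ->
  wdist u v = \sum_(0 <= i < size u) D (nth y u i) (nth y v i).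
Proof.
move=> suv; rewrite /wdist (big_nth (y, y)) size_zip -suv minnn.
by apply: eq_bigr => i _; rewrite nth_zip.
Qed.

(** The word of length [n] with the letters of [u] at the positions [P] and the
    filler [y] elsewhere.  When [P] is longer than [u] its last positions also
    receive [y], so that one can lengthen [P] without changing the word. *)
Definition place y n P u : seq T := mkseq (fun i => nth y u (index i P)) n.

Lemma wdist_place y n P u v : uniq P -> all (gtn n) P ->
    size u = size P -> size v = size P ->
  wdist (place y n P u) (place y n P v) = wdist u v.
Proof.
move=> uP /allP Pn su sv.
rewrite (wdistE y) ?size_mkseq // (wdistE y (u := u)) ?su ?sv //.
pose F i := D (nth y u i) (nth y v i).
rewrite (eq_big_nat _ _ (F2 := fun i => F (index i P))); last first.
  by move=> i /= ltin; rewrite !nth_mkseq.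
rewrite (bigID (mem P)) /= addrC big1 ?add0r => [|i iP]; last first.
  by rewrite /F !nth_default ?D0 // leqNgt ?su ?sv index_mem.
rewrite -big_filter (perm_big P) /=; last first.
  apply: uniq_perm => [||i] //; first by rewrite filter_uniq // iota_uniq.
  by rewrite mem_filter mem_index_iota andb_idr // => /Pn.
by rewrite (big_nth 0%N); apply: eq_big_nat => i /= lti; rewrite index_uniq.
Qed.

Lemma index_catr (s t : seq nat) i : i \notin s -> index i (s ++ t) = (size s + index i t)%N.
Proof. by move=> /negPf si; rewrite index_cat si. Qed.

(** Deleting from [w] the letters that look like the filler, together with their
    positions, does not change the labels of the resulting word, even if fresh
    positions [E] are appended. *)
Lemma nth_mask_place kap y P E w i (iE : i \in P -> i \notin E) :
    size w = size P -> uniq P ->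
  let m := map (fun x => kap x != kap y) w in
  kap (nth y (mask m w) (index i (mask m P ++ E))) =
  kap (nth y w (index i P)).
Proof.
elim: P w iE => [|p P IH] [|x w] //= iE; first by rewrite !nth_nil.
move=> [sw] /andP[pP uP].
have {}IH := IH w (fun iP => iE (mem_behead (s := p :: P) iP)) sw uP.
have [epi|npi] := eqVneq p i; last first.
  by case: ifP => /= _; rewrite ?(negPf npi) IH.
subst i; case: ifP => /=; rewrite ?eqxx //= => /negPn/eqP ->.
rewrite nth_default //; set m := map _ w.
rewrite index_catr; last by apply: contra pP; apply: mem_mask.
rewrite !size_mask ?size_map //.
by rewrite leq_addr.
Qed.

(** Every colouring of long words can be restricted to an enlarged copy of the
    words of length [N] on which it sees letters only through their label [kap].
    The factor [s] is chosen before the colouring: in the end it is the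
    normalisation that turns the copy into an isometric one. *)
Definition homogenizable kap : Prop :=
  forall k N : nat, exists n s : nat, (0 < s)%N /\
  forall c : seq T -> 'I_k, exists Phi : seq T -> seq T,
    (forall z z', size z = N -> size z' = N ->
       size (Phi z) = n /\ wdist (Phi z) (Phi z') = wdist z z' *+ s) /\
    (forall z z', size z = N -> size z' = N -> map kap z = map kap z' ->
       c (Phi z) = c (Phi z')).

Lemma homogenizable_inj kap : injective kap -> homogenizable kap.
Proof.
move=> injk k N; exists N, 1%N; split=> // c; exists id; split=> [z z' -> //|].
by move=> z z' _ _ /(inj_map injk) ->.
Qed.

Lemma homogenizable_coarse kap kap' :
    (forall x x', kap' x = kap' x' -> kap x = kap x') ->
  homogenizable kap -> homogenizable kap'.
Proof.
move=> sub good k N; have [n [s [s0 H]]] := good k N; exists n, s; split=> // c.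
have [Phi [Phi1 Phi2]] := H c; exists Phi; split=> // z z' sz sz' e; apply: Phi2 => //.
elim: z z' e {sz sz'} => [|x z IH] [|x' z'] //= [ex ez].
by rewrite (IH z') // (sub x x').
Qed.

Lemma size_placed_mask (Q : seq nat) M (m : bitseq) : size m = M -> size Q = (M + M)%N ->
  size (mask m (take M Q) ++ take (M - count id m) (drop M Q)) = M.
Proof.
move=> sm sQ; have cM : (count id m <= M)%N by rewrite -sm count_size.
rewrite size_cat size_mask ?size_takel ?size_drop ?sQ ?addnK ?leq_addr ?leq_subr ?sm //.
by rewrite subnKC.
Qed.

(** The engine of the proof.  Each letter [x] is expanded into the block of the
    [g x]; the blocks are written on a set of positions on which Ramsey's
    theorem applies, and the rest is filled with [y].  The colour of the result
    depends only on what is left of the blocks after deleting the letters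
    labelled like [y], so two letters whose blocks have the same remainder may
    receive the same new label. *)
Lemma homogenizable_expand (gs : seq (T -> T)) y kap kap' :
    (0 < size gs)%N ->
    (forall x x', \sum_(g <- gs) D (g x) (g x') = D x x' *+ size gs) ->
    (forall x x', kap' x = kap' x' ->
       [seq i <- [seq kap (g x) | g <- gs] | i != kap y] =
       [seq i <- [seq kap (g x') | g <- gs] | i != kap y]) ->
  homogenizable kap -> homogenizable kap'.
Proof.
move=> gs0 gsD sub good k N; set q := size gs in gs0 gsD.
pose M := (N * q)%N; pose C := {ffun M.-tuple T -> 'I_k}.
have [n' Hn'] := ramsey_subseq C M (M + M).
have [n [s [s0 Hs]]] := good k n'.
exists n, (q * s)%N; split=> [|c]; first by rewrite muln_gt0 gs0.
have [Phi [PhiD Phic]] := Hs c.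
(* The colour of a set of positions records the colours of all the words that
   can be written there. *)
pose g P : C := [ffun w : M.-tuple T => c (Phi (place y n' P w))].
have [||Q [col [QA sQ HQ]]] := Hn' (iota 0 n') g; rewrite ?iota_uniq ?size_iota //.
have uQ : uniq Q by rewrite (subseq_uniq QA) ?iota_uniq.
have [P0 sP0 P0Q] : exists2 P0, size P0 = M & take M Q = P0.
  by exists (take M Q); rewrite ?size_takel ?sQ ?leq_addr.
have P0sub : subseq P0 Q by rewrite -P0Q take_subseq.
have uP0 : uniq P0 by rewrite (subseq_uniq P0sub).
have P0n : all (gtn n') P0.
  by apply/allP => i /(mem_subseq (subseq_trans P0sub QA)); rewrite mem_iota.
pose expand z := flatten [seq [seq h x | h <- gs] | x <- z].
have sexp z : size z = N -> size (expand z) = M.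
  rewrite /M => <-; elim: z => //= x z IH.
  by rewrite size_cat size_map IH mulSn.
have dexp z z' : size z = N -> size z' = N ->
    wdist (expand z) (expand z') = wdist z z' *+ q.
  move=> sz sz'; have {sz sz'} : size z = size z' by rewrite sz.
  rewrite /wdist; elim: z z' => [|x z IH] [|x' z'] //=; first by rewrite !big_nil mul0rn.
  move=> [ss]; rewrite zip_cat ?size_map // big_cat /= IH // big_cons /= mulrnDl; congr (_ + _).
  by rewrite -gsD; elim: (gs) => [|h hs IHh] /=; rewrite ?big_nil // !big_cons IHh.
(* A word on [P0] may be replaced by its remainder, left justified on [P0] and
   padded with fillers: the deleted positions are traded for positions in the
   second half of [Q], which leaves the labels unchanged, and then homogeneity
   of [Q] moves the remainder back to [P0]. *)
pose pad w := w ++ nseq (M - size w) y.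
pose del w := [seq x <- w | kap x != kap y].
have kapc w : size w = M ->
    c (Phi (place y n' P0 w)) = c (Phi (place y n' P0 (pad (del w)))).
  move=> sw; pose m := [seq kap x != kap y | x <- w].
  have delE : del w = mask m w by rewrite /del filter_mask.
  have sm : size m = M by rewrite size_map.
  pose E := take (M - count id m) (drop M Q).
  pose P1 := mask m P0 ++ E.
  have sP1 : size P1 = M by rewrite /P1 -P0Q size_placed_mask.
  have P1Q : subseq P1 Q.
    rewrite -[Q in subseq _ Q](cat_take_drop M) P0Q cat_subseq ?mask_subseq //.
    exact: take_subseq.
  have padE P : place y n' P (pad (del w)) = place y n' P (del w).
    apply: eq_mkseq => i; rewrite nth_cat; case: ltnP => // le.
    by rewrite nth_nseq if_same nth_default.
  have spad : size (pad (del w)) == M.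
    rewrite size_cat size_nseq subnKC // -sw.
    by rewrite size_filter count_size.
  have := HQ P0 P0sub sP0; rewrite -(HQ P1 P1Q sP1) => /ffunP/(_ (Tuple spad)).
  rewrite !ffunE /= => ->; rewrite padE delE; apply: Phic; rewrite ?size_mkseq //.
  rewrite -!map_comp; apply: eq_map => i /=; rewrite nth_mask_place // ?sw //.
  move=> iP0; move: uQ; rewrite -(cat_take_drop M Q) cat_uniq P0Q => /and3P[_ /hasPn no _].
  by apply: contraL iP0 => /mem_take; exact: no.
exists (fun z => Phi (place y n' P0 (expand z))); split=> z z' sz sz'.
  have [|| sPhi ->] := PhiD (place y n' P0 (expand z)) (place y n' P0 (expand z')).
  - by rewrite size_mkseq.
  - by rewrite size_mkseq.
  by rewrite sPhi wdist_place ?sexp // dexp // mulrnA.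
move=> ekap; rewrite kapc ?sexp // [RHS]kapc ?sexp //.
have : map kap (del (expand z)) = map kap (del (expand z')).
  rewrite -!(filter_map kap (fun i => i != kap y)) /expand.
  elim: z z' ekap {sz sz'} => [|x z IH] [|x' z'] //= [ex ez].
  rewrite !map_cat !filter_cat (IH z') // -!map_comp; congr (_ ++ _).
  exact: sub ex.
move=> edel; apply: Phic; rewrite ?size_mkseq //.
rewrite -!map_comp; apply: eq_map => i /=.
have es : size (del (expand z)) = size (del (expand z')).
  by rewrite -(size_map kap) edel size_map.
rewrite !nth_cat -es; case: ltnP => lt; last by rewrite !nth_nseq !if_same.
by rewrite -(nth_map y 0%N) // edel (nth_map y) // -es.
Qed.

End Words.

(** * Identifying letters in the same orbit of a permutation *)

Lemma map_rot_periodic (I : Type) (f : nat -> I) q i : i <= q ->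
    (forall t, f (t + q) = f t) ->
  [seq f (t + i) | t <- iota 0 q] = rot i [seq f t | t <- iota 0 q].
Proof.
move=> leiq fq; rewrite -map_rot /rot drop_iota take_iota add0n (minn_idPl leiq).
rewrite (eq_map (g := f \o addn i)); last by move=> t; rewrite /= addnC.
rewrite map_comp -iotaDl addn0 -{1}(subnK leiq) iotaD !map_cat; congr (_ ++ _).
rewrite subnKC // -{1}[q]addn0 iotaDl -map_comp; apply: eq_map => t /=.
by rewrite addnC fq.
Qed.

Section Merge.
Variables (T : finType) (V : nmodType) (D : T -> T -> V).
Hypothesis D0 : forall x, D x x = 0%R.
Variable a : {perm T}.
Hypothesis aD : forall x x', D (a x) (a x') = D x x'.
Implicit Types (x y : T) (kap : T -> nat).

Definition equivariant_labels kap :=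
  forall x x', kap x = kap x' -> kap (a x) = kap (a x').

(** Label [0] is shared by all letters that look like one of
    [y, a y, ..., a^r y]; other labels are shifted by one to make room. *)
Definition merge_iterates kap y r x : nat :=
  if kap x \in [seq kap (iter i a y) | i <- iota 0 r.+1] then 0
  else (kap x).+1.

Lemma merge_iterates0P kap y r x :
  reflect (exists2 i, i <= r & kap x = kap (iter i a y)) (merge_iterates kap y r x == 0).
Proof.
rewrite /merge_iterates; apply: (iffP idP) => [|[i le ->]].
  case: ifP => // /mapP[i]; rewrite mem_iota ltnS => /andP[_ le] -> _.
  by exists i.
by rewrite map_f // mem_iota ltnS.
Qed.

Lemma merge_iterates_eq kap y r x x' : merge_iterates kap y r x = merge_iterates kap y r x' ->
  kap x = kap x' \/ merge_iterates kap y r x = 0 /\ merge_iterates kap y r x' = 0.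
Proof. by rewrite /merge_iterates; do 2!case: ifP => //; [right|left; case: H]. Qed.

Lemma merge_iterates_congr kap y r x x' : kap x = kap x' ->
  merge_iterates kap y r x = merge_iterates kap y r x'.
Proof. by rewrite /merge_iterates => ->. Qed.

Lemma equivariant_iter kap n x x' : equivariant_labels kap ->
  kap x = kap x' -> kap (iter n a x) = kap (iter n a x').
Proof. by move=> eqv e; elim: n => //= n; apply: eqv. Qed.

Lemma iter_order x : iter #[a]%g a x = x.
Proof. by rewrite -permX expg_order perm1. Qed.

(** Induction on [r].  Suppose that [y, ..., a^r y] already share the label of
    the filler.  For [i <= r.+1] the block of [a^i y] is the rotation by [i] of
    the block of [y], and the [i] letters that move from the front to the back
    are among those that get deleted. *)
Lemma homogenizable_merge_iterates kap y r : equivariant_labels kap -> r < #[a]%g ->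
  homogenizable D kap -> homogenizable D (merge_iterates kap y r).
Proof.
move=> eqv + good; elim: r => [|r IH] ltr.
  apply: homogenizable_coarse good => x x' /merge_iterates_eq[//|].
  move=> [/eqP/merge_iterates0P[i + ->] /eqP/merge_iterates0P[j + ->]].
  by rewrite !leqn0 => /eqP-> /eqP->.
have {}IH := IH (ltnW ltr).
set q := #[a]%g in ltr *.
pose gs : seq (T -> T) := [seq (fun x => iter t a x) | t <- iota 0 q].
have sgs : size gs = q by rewrite size_map size_iota.
apply: (@homogenizable_expand T V D D0 gs y) IH.
- by rewrite sgs order_gt0.
- move=> x x'; rewrite sgs big_map (eq_bigr (fun=> D x x')) => [|t _].
    by have := sumr_const_nat q 0 (D x x'); rewrite /index_iota subn0.
  by elim: t => //= t <-.
set kr := merge_iterates kap y r.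
have kry : kr y = 0 by apply/eqP/merge_iterates0P; exists 0.
rewrite kry.
pose word x := [seq kr (iter t a x) | t <- iota 0 q].
have wordE x : [seq kr (g x) | g <- gs] = word x by rewrite -map_comp.
have word_congr x x' : kap x = kap x' -> word x = word x'.
  by move=> e; apply: eq_map => t; apply: merge_iterates_congr; apply: equivariant_iter.
have word_rot i : i <= r.+1 ->
    [seq j <- word (iter i a y) | j != 0] = [seq j <- word y | j != 0].
  move=> leir; have leiq : i <= q by apply: leq_trans leir _; apply: ltnW.
  have -> : word (iter i a y) = rot i (word y).
    rewrite -(@map_rot_periodic _ (fun t => kr (iter t a y))) //.
      by apply: eq_map => t; rewrite iterD.
    by move=> t; rewrite iterD iter_order.
  rewrite /rot filter_cat -[in RHS](cat_take_drop i (word y)) filter_cat.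
  suff -> : [seq j <- take i (word y) | j != 0] = [::] by rewrite cats0.
  rewrite -map_take take_iota (minn_idPl leiq); apply/eqP.
  rewrite -[_ == _]negbK -has_filter -all_predC all_map; apply/allP => t.
  rewrite mem_iota /= negbK => lt; apply/merge_iterates0P; exists t => //.
  by rewrite -ltnS (leq_trans lt).
move=> x x'; rewrite !wordE => /merge_iterates_eq[/word_congr -> //|].
move=> [/eqP/merge_iterates0P[i lei /word_congr->] /eqP/merge_iterates0P[j lej /word_congr->]].
by rewrite !word_rot.
Qed.

(** Merging only a part of an orbit of [a] can break equivariance; it is restored
    once the orbit is complete, which allows passing to another orbit. *)
Lemma merge_iterates_equivariant kap y : equivariant_labels kap ->
  equivariant_labels (merge_iterates kap y #[a]%g.-1).
Proof.
move=> eqv; set m := merge_iterates _ _ _.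
have ord_gt0 := order_gt0 a.
have m0 x : m x == 0 -> m (a x) == 0.
  move=> /merge_iterates0P[i lei e]; apply/merge_iterates0P.
  have [ei|ltiq] := eqVneq i #[a]%g.-1; last first.
    exists i.+1; last exact: eqv.
    by rewrite ltn_neqAle ltiq.
  exists 0 => //; rewrite (eqv _ _ e) ei -iterS prednK //.
  by rewrite iter_order.
have {}m0 x : m x = 0 -> m (a x) = 0 by move=> /eqP/m0/eqP.
move=> x x' /merge_iterates_eq[e|[/m0-> /m0->] //].
by apply: merge_iterates_congr; apply: eqv.
Qed.

Lemma merge_iterates_orbit kap y : equivariant_labels kap ->
  merge_iterates kap y #[a]%g.-1 (a y) = merge_iterates kap y #[a]%g.-1 y.
Proof.
move=> eqv; set m := merge_iterates _ _ _.
have m0 : m y = 0 by apply/eqP/merge_iterates0P; exists 0.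
rewrite m0; apply/eqP/merge_iterates0P; have := order_gt0 a.
case e: #[a]%g => [//|[|q]] _; last by exists 1.
by exists 0 => //=; have /= := iter_order y; rewrite e /= => ->.
Qed.

Lemma homogenizable_invariant kap : equivariant_labels kap ->
    homogenizable D kap ->
  exists kap', [/\ homogenizable D kap',
    forall x x', kap x = kap x' -> kap' x = kap' x' &
    forall x, kap' (a x) = kap' x].
Proof.
move=> eqv good.
suff [kap' [good' eqv' sub inv]] : exists kap', [/\ homogenizable D kap',
    equivariant_labels kap', forall x x', kap x = kap x' -> kap' x = kap' x' &
    {in enum T, forall x, kap' (a x) = kap' x}].
  by exists kap'; split=> // x; apply: inv; rewrite mem_enum.
elim: (enum T) => [|y ys [kap' [good' eqv' sub inv]]].
  by exists kap.
exists (merge_iterates kap' y #[a]%g.-1); split.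
- apply: homogenizable_merge_iterates => //.
  by rewrite prednK.
- exact: merge_iterates_equivariant.
- by move=> x x' /sub; apply: merge_iterates_congr.
move=> x; rewrite inE => /predU1P[->|/inv]; first exact: merge_iterates_orbit.
exact: merge_iterates_congr.
Qed.

End Merge.

(** * Identifying letters in the same orbit of a soluble group *)

Section Tower.
Variables (T : finType) (V : nmodType) (D : T -> T -> V).
Hypothesis D0 : forall x, D x x = 0%R.
Local Open Scope group_scope.

Definition orbit_label (G : {group {perm T}}) (x : T) : nat :=
  enum_rank (orbit 'P G x).

Lemma orbit_labelP (G : {group {perm T}}) x x' :
  orbit_label G x = orbit_label G x' <-> exists2 g : {perm T}, g \in G & g x = x'.
Proof.
split=> [/ord_inj/enum_rank_inj e|[g gG <-]].
  have : x' \in orbit 'P G x by rewrite e orbit_refl.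
  by case/orbitP=> g gG e'; exists g.
congr (nat_of_ord (enum_rank _)); apply/orbit_eqP; rewrite orbit_sym.
by apply/orbitP; exists g.
Qed.

(** Induction on the order of [G].  A normal subgroup [H] of prime index is
    handled by induction, and [G] is generated by [H] and one element [a].  As
    [a] normalises [H], it permutes the orbits of [H], so
    [homogenizable_invariant] applies to the labelling by orbits of [H]. *)
Lemma homogenizable_solvable (G : {group {perm T}}) : solvable G ->
    (forall g x x', g \in G -> D (g x) (g x') = D x x') ->
  homogenizable D (orbit_label G).
Proof.
have [m] := ubnP #|G|; elim: m G => // m IH G; rewrite ltnS => leGm solG DG.
have [G1|ntG] := eqVneq (G : {set _}) 1.
  apply: homogenizable_inj => x x' /orbit_labelP[g].
  by rewrite G1 inE => /eqP->; rewrite perm1.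
have [H nHG prGH] := sol_prime_factor_exists solG ntG.
have sHG := normal_sub nHG.
have goodH : homogenizable D (orbit_label H).
  apply: IH.
  - apply: leq_trans leGm; rewrite -(Lagrange sHG).
    by rewrite ltn_Pmulr ?prime_gt1.
  - exact: solvableS solG.
  - by move=> g x x' /(fintype.subsetP sHG); apply: DG.
have /cyclicP[xb Gxb] : cyclic (G / H).
  by rewrite prime_cyclic // card_quotient ?normal_norm.
have : xb \in G / H by rewrite Gxb cycle_id.
case/morphimP => a aN aG /= xbE.
have GHa : G \subset H * <[a]>.
  by rewrite -quotientSK ?normal_norm // Gxb xbE quotient_cycle.
have eqv : equivariant_labels a (orbit_label H).
  move=> x x' /orbit_labelP[h hH <-]; apply/orbit_labelP.
  exists (h ^ a); first by rewrite memJ_norm.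
  by rewrite conjgE !permM permK.
have aD x x' : D (a x) (a x') = D x x' by apply: DG.
have [kap [good sub inv]] := homogenizable_invariant D0 aD eqv goodH.
apply: homogenizable_coarse good => x x' /orbit_labelP[g /(fintype.subsetP GHa)/mulsgP[h b hH]].
move=> /cycleP[i ->] -> <-; rewrite permM permX.
have -> : kap (iter i a (h x)) = kap (h x) by elim: i => //= i <-.
by apply: sub; apply/orbit_labelP; exists h.
Qed.

End Tower.

(** * Transfer of solubility *)

Section SolubleTransfer.
Local Open Scope classical_set_scope.
Local Open Scope group_scope.

Section Subgroups.
Variable G : groupType.
Implicit Types (H K : set G) (x y : G).

Lemma is_subgroupP H : is_subgroup H <->
  [/\ H 1, forall x y, H x -> H y -> H (x * y) & forall x, H x -> H x^-1].
Proof.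
rewrite /is_subgroup; split=> [gH|[H1 HM HV]].
  have HM := group_closedM gH; have HV := group_closedV gH.
  split; first by have /asboolP := gH.1.
  - by move=> x y /asboolP xH /asboolP yH; apply/asboolP; apply: HM.
  - by move=> x /asboolP xH; apply/asboolP; apply: HV.
split; first exact/asboolP.
by move=> x y /asboolP xH /asboolP yH; apply/asboolP; apply: HM => //; apply: HV.
Qed.

Lemma derived_is_subgroup H : is_subgroup (derived_subgroup H).
Proof.
apply/is_subgroupP; split=> [K [/is_subgroupP[]]//|x y xD yD K KP|x xD K KP].
  by have [_ KM _] := (is_subgroupP K).1 KP.1; apply: KM; [apply: xD|apply: yD].
by have [_ _ KV] := (is_subgroupP K).1 KP.1; apply: KV; apply: xD.
Qed.

Lemma derived_comm H x y : H x -> H y -> derived_subgroup H [~ x, y].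
Proof. by move=> Hx Hy; apply: sub_gen_smallest; exists x => //; exists y. Qed.

End Subgroups.

(** The relation [rho] plays the role of an injective homomorphism from [H1] to a
    power of [H2].  A function would not do: a permutation of a set of points
    determines an isometry inducing it only on that set. *)
Lemma soluble_transfer (G1 G2 : groupType) (I : Type)
    (rho : G1 -> (I -> G2) -> Prop) :
    rho 1 (fun=> 1) ->
    (forall x x' g g', rho x g -> rho x' g' -> rho (x * x') (fun i => g i * g' i)) ->
    (forall x g, rho x g -> rho x^-1 (fun i => (g i)^-1)) ->
    (forall x, rho x (fun=> 1) -> x = 1) ->
  forall (H1 : set G1) (H2 : set G2), is_subgroup H1 ->
    (forall x, H1 x -> exists2 g, rho x g & forall i, H2 (g i)) ->
  soluble H2 -> soluble H1.
Proof.
move=> rho1 rhoM rhoV rhoK H1 H2 sH1 H12 [n Hn]; exists n.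
suff [sub gr] : (forall x, iter n (@derived_subgroup G1) H1 x ->
     exists2 g, rho x g & forall i, iter n (@derived_subgroup G2) H2 (g i)) /\
     is_subgroup (iter n (@derived_subgroup G1) H1).
  apply/seteqP; split=> [x /sub[g xg]|x ->]; last by have [] := (is_subgroupP _).1 gr.
  rewrite Hn => g1; apply: rhoK; suff <- : g = (fun=> 1) by [].
  by apply/funext => i; apply: g1.
elim: n {Hn} => [|n [sub gr]] //=.
set K1 := iter n _ H1 in sub gr *; set K2 := iter n _ H2 in sub *.
split; last exact: derived_is_subgroup.
have /is_subgroupP[D1 DM DV] := derived_is_subgroup K2.
pose S := [set x | exists2 g, rho x g & forall i, derived_subgroup K2 (g i)].
suff : derived_subgroup K1 `<=` S by [].
apply: smallest_sub.
  apply/is_subgroupP; split.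
  - by exists (fun=> 1).
  - move=> x y [g xg Dg] [h yh Dh]; exists (fun i => g i * h i); first exact: rhoM.
    by move=> i; apply: DM.
  - by move=> x [g xg Dg]; exists (fun i => (g i)^-1); [apply: rhoV|move=> i; apply: DV].
move=> _ [x /sub[g xg Kg] [y /sub[h yh Kh] <-]].
exists (fun i => [~ g i, h i]); last by move=> i; apply: derived_comm.
rewrite commgEl conjgE; apply: (rhoM); first exact: rhoV.
by apply: (rhoM); [exact: rhoV|exact: rhoM].
Qed.

Lemma group_is_subgroup (gT : finGroupType) (G : {group gT}) :
  is_subgroup [set x : gT | x \in G].
Proof.
apply/is_subgroupP; split=> [|x y|x] /=.
- exact: group1.
- exact: groupM.
- by move=> xG; rewrite groupV.
Qed.

Lemma soluble_solvable (gT : finGroupType) (G : {group gT}) :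
  soluble [set x : gT | x \in G] -> solvable G.
Proof.
move=> [n Hn]; apply/derivedP; exists n; apply/trivgP/fintype.subsetP => x xG.
suff : iter n (@derived_subgroup gT) [set x : gT | x \in G] x by rewrite Hn => ->; apply: set11.
elim: n x xG {Hn} => [|n IH] x //=; rewrite dergSn.
have gD := derived_is_subgroup (iter n (@derived_subgroup gT) [set x : gT | x \in G]).
have [D1 DM DV] := (is_subgroupP _).1 gD.
set D := derived_subgroup _ in gD D1 DM DV *.
have grp : group_set [set x | `[<D x>]]%SET.
  apply/group_setP; split; first by rewrite inE; apply/asboolP.
  by move=> y z; rewrite !finset.in_set => /asboolP yD /asboolP zD; apply/asboolP; apply: DM.
suff /fintype.subsetP sub : [~: G^`(n), G^`(n)] \subset group grp.
  by move=> /sub; rewrite inE => /asboolP.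
rewrite gen_subG; apply/fintype.subsetP => _ /imset2P[y z yG zG ->].
by rewrite inE; apply/asboolP; apply: derived_comm; apply: IH.
Qed.

End SolubleTransfer.

(** * Squared distances and soluble Ramsey sets *)

Section Distances.
Local Open Scope ring_scope.
Variable R : realType.
Local Open Scope ring_scope.

Definition sqdist m (x y : 'rV[R]_m) : R := \sum_(i < m) (x ord0 i - y ord0 i) ^+ 2.

Lemma sqdist_ge0 m (x y : 'rV[R]_m) : 0 <= sqdist x y.
Proof. by apply: sumr_ge0 => i _; apply: sqr_ge0. Qed.

Lemma edistE m n (x y : 'rV[R]_m) (x' y' : 'rV[R]_n) :
  edist x y = edist x' y' <-> sqdist x y = sqdist x' y'.
Proof.
split=> [|e]; last by rewrite /edist -!/(sqdist _ _) e.
by move=> /eqP; rewrite /edist eqr_sqrt ?sqdist_ge0 // => /eqP.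
Qed.

Lemma sqdistxx m (x : 'rV[R]_m) : sqdist x x = 0.
Proof. by apply: big1 => i _; rewrite subrr expr0n. Qed.

Lemma sqdistZ m a (x y : 'rV[R]_m) : sqdist (a *: x) (a *: y) = a ^+ 2 * sqdist x y.
Proof.
by rewrite /sqdist mulr_sumr; apply: eq_bigr => i _; rewrite !mxE -mulrBr exprMn.
Qed.

Lemma sqdist_isom m (f : eisometry R m) x y : sqdist (f x) (f y) = sqdist x y.
Proof. exact/edistE/isom_dist. Qed.

Lemma sqdist_mxvec m n (A B : 'M[R]_(m, n)) :
  sqdist (mxvec A) (mxvec B) = \sum_i sqdist (row i A) (row i B).
Proof.
rewrite /sqdist (reindex _ (curry_mxvec_bij m n)) /=.
rewrite (pair_big xpredT xpredT) /=; apply: eq_bigr => -[i j] _ /=.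
by rewrite !mxvecE !mxE.
Qed.

End Distances.

Section Ramsey.
Local Open Scope classical_set_scope.
Variable R : realType.
Local Open Scope ring_scope.

(** The group of symmetries is first replaced by the finite group [G] of
    permutations that it induces on [W].  Words of length [n] over [W] are points
    of the [n]-th power of the space, rescaled by the factor provided by
    [homogenizable_solvable]; by transitivity all one-letter words are labelled
    alike, so their images have the same colour. *)
Lemma soluble_ramsey d m (A : set 'rV[R]_d) (W : set 'rV[R]_m)
    (f : 'rV[R]_d -> 'rV[R]_m) :
  soluble_set W -> (forall x y, A x -> A y -> edist (f x) (f y) = edist x y) ->
  f @` A `<=` W -> ramsey A.
Proof.
move=> [/finite_seqP[s Ws] [H [sH HW solH trH]]] fA fAW k k0.
have [/eqP A0|/set0P[x0 Ax0]] := boolP (A == set0).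
  exists 0%N => c; exists set0; last by exists (Ordinal k0).
  by exists (fun=> 0); split; rewrite A0 ?image_set0 // => x y [].
have sP x : A x -> f x \in s.
  by move=> Ax; have : W (f x) by [apply: fAW; exists x]; rewrite Ws.
pose T := seq_sub s; pose t0 : T := SeqSub (sP _ Ax0).
pose D (t t' : T) := sqdist (val t) (val t').
(* [h] undoes [g], rather than inducing it, because permutations compose in the
   opposite order to isometries. *)
pose rho (g : {perm T}) (h : unit -> eisometry R m) :=
  forall t, h tt (val (g t)) = val t.
pose G := [set g : {perm T} | `[<exists2 h, H h & rho g (fun=> h)>]]%SET.
have /is_subgroupP[H1 HM HV] := sH.
have rho1 : rho 1%g (fun=> 1%g) by move=> t; rewrite perm1.
have rhoM g g' h h' : rho g h -> rho g' h' -> rho (g * g')%g (fun i => h i * h' i)%g.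
  by move=> gh gh' t; rewrite permM /= gh' gh.
have grG : group_set G.
  apply/group_setP; split; first by rewrite finset.in_set; apply/asboolP; exists 1%g.
  move=> g g'; rewrite !finset.in_set => /asboolP[h Hh gh] /asboolP[h' Hh' gh'].
  by apply/asboolP; exists (h * h')%g; [exact: HM|exact: (rhoM g g' (fun=> h) (fun=> h'))].
have solG : solvable (group grG).
  apply: soluble_solvable; apply: (soluble_transfer rho1 rhoM _ _ _ _ solH).
  - move=> g h gh t; rewrite -[t in RHS](permKV g); set t' := (g^-1%g t).
    by rewrite -(gh t') [LHS]isom_funK.
  - move=> g g1; apply/permP => t; apply: val_inj; rewrite perm1; exact: g1.
  - exact: group_is_subgroup.
  - by move=> g; rewrite /= finset.in_set => /asboolP[h Hh gh]; exists (fun=> h).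
have goodD : homogenizable D (orbit_label (group grG)).
  apply: homogenizable_solvable => // [t|g t t']; first exact: sqdistxx.
  rewrite finset.in_set => /asboolP[h _ gh].
  by rewrite /D -(sqdist_isom h) !gh.
have Wval (t : T) : W (val t) by rewrite Ws /=; apply: valP.
have transG (t t' : T) : orbit_label (group grG) t = orbit_label (group grG) t'.
  have [h Hh ht] := trH _ _ (Wval t') (Wval t).
  have hs (u : T) : Defs.isom_inv h (val u) \in s.
    have hW : h @` W = W := HW _ Hh.
    have := Wval u; rewrite -{1}hW => -[x Wx <-].
    by rewrite isom_funK; move: Wx; rewrite Ws.
  pose g (u : T) : T := SeqSub (hs u).
  have gI : injective g.
    by move=> u v [] /(can_inj (isom_invK h)) /val_inj.
  apply/orbit_labelP; exists (perm gI).
    by rewrite finset.in_set; apply/asboolP; exists h => // u; rewrite permE /= isom_invK.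
  by apply: val_inj; rewrite permE /= -ht isom_funK.
have [n [q [q0 Hq]]] := goodD k 1%N.
exists (n * m)%N => c.
pose pt (u : seq T) : 'rV[R]_(n * m) :=
  mxvec (\matrix_(i < n) (Num.sqrt (q%:R^-1) *: val (nth t0 u i))).
have ptD u v : size u = n -> size v = n -> sqdist (pt u) (pt v) = q%:R^-1 * wdist D u v.
  move=> su sv; rewrite sqdist_mxvec (wdistE D t0) ?su // big_mkord mulr_sumr.
  apply: eq_bigr => i _; rewrite !rowK sqdistZ sqr_sqrtr //.
  by rewrite invr_ge0 ler0n.
have [Phi [PhiD Phic]] := Hq (fun u => c (pt u)).
pose F x := pt (Phi [:: insubd t0 (f x)]).
exists (F @` A).
  exists F; split=> // x y Ax Ay; rewrite -(fA _ _ Ax Ay); apply/edistE.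
  have [//|//|sx eD] := PhiD [:: insubd t0 (f x)] [:: insubd t0 (f y)].
  have [//|//|sy _] := PhiD [:: insubd t0 (f y)] [:: insubd t0 (f y)].
  rewrite ptD // eD -[X in _ * X]mulr_natl mulKf ?pnatr_eq0 -?lt0n //.
  by rewrite /wdist big_seq1 /= /D !insubdK // sP.
exists (c (pt (Phi [:: t0]))) => _ [x Ax <-]; apply: Phic => //=.
by congr [:: _].
Qed.

End Ramsey.

(** * Affine combinations and orthogonal projection *)

Section Euclid.
Local Open Scope ring_scope.
Variable R : realType.

Lemma sqdistC m (x y : 'rV[R]_m) : sqdist x y = sqdist y x.
Proof. by apply: eq_bigr => i _; rewrite -opprB sqrrN. Qed.

Lemma sqdist_eq0 m (x y : 'rV[R]_m) : sqdist x y = 0 -> x = y.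
Proof.
move=> /eqP; rewrite psumr_eq0 => [/allP e|i _]; last exact: sqr_ge0.
apply/rowP => i; apply/eqP; rewrite -subr_eq0 -sqrf_eq0.
by apply: (e i); rewrite mem_index_enum.
Qed.

Lemma sqdist_row_mx m n (a a' : 'rV[R]_m) (b b' : 'rV[R]_n) :
  sqdist (row_mx a b) (row_mx a' b') = sqdist a a' + sqdist b b'.
Proof.
rewrite /sqdist big_split_ord /=; congr (_ + _).
  by apply: eq_bigr => i _; rewrite !row_mxEl.
by apply: eq_bigr => i _; rewrite !row_mxEr.
Qed.

(** Distances to an affine combination are determined by distances to and between
    the combined points.  Hence affine combinations are preserved by isometries,
    and also by maps that are isometric only on the combined points. *)
Lemma sqdist_barycenter m r (c : 'I_r -> R) (x : 'I_r -> 'rV[R]_m) q :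
    \sum_i c i = 1 ->
  sqdist q (\sum_i c i *: x i) = \sum_i c i * sqdist q (x i) -
    2^-1 * \sum_i \sum_j c i * c j * sqdist (x i) (x j).
Proof.
move=> c1.
have -> : \sum_i c i * sqdist q (x i) =
    \sum_k \sum_i c i * (q ord0 k - x i ord0 k) ^+ 2.
  by rewrite [RHS]exchange_big; apply: eq_bigr => i _; rewrite mulr_sumr.
have -> : \sum_i \sum_j c i * c j * sqdist (x i) (x j) =
    \sum_k \sum_i \sum_j c i * c j * (x i ord0 k - x j ord0 k) ^+ 2.
  rewrite [RHS]exchange_big; apply: eq_bigr => i _; rewrite [RHS]exchange_big.
  by apply: eq_bigr => j _; rewrite mulr_sumr.
rewrite mulr_sumr -sumrB; apply: eq_bigr => k _.
rewrite summxE; under eq_bigr do rewrite mxE.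
set a := q ord0 k; pose S1 := \sum_i c i * x i ord0 k; pose S2 := \sum_i c i * x i ord0 k ^+ 2.
have -> : \sum_i c i * (a - x i ord0 k) ^+ 2 = a ^+ 2 - 2 * a * S1 + S2.
  rewrite (eq_bigr (fun i => c i * a ^+ 2 - 2 * a * (c i * x i ord0 k)
    + c i * x i ord0 k ^+ 2)); last by move=> i _; ring.
  by rewrite big_split sumrB /= -mulr_suml -mulr_sumr c1 mul1r.
have -> : \sum_i \sum_j c i * c j * (x i ord0 k - x j ord0 k) ^+ 2
    = 2 * S2 - 2 * S1 ^+ 2.
  rewrite (eq_bigr (fun i => c i * x i ord0 k ^+ 2 -
    2 * S1 * (c i * x i ord0 k) + S2 * c i)) => [|i _].
    rewrite big_split sumrB /= -!mulr_sumr c1 -/S1 -/S2; ring.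
  rewrite (eq_bigr (fun j => c i * x i ord0 k ^+ 2 * c j -
    2 * (c i * x i ord0 k) * (c j * x j ord0 k)
    + c i * (c j * x j ord0 k ^+ 2))); last by move=> j _; ring.
  by rewrite big_split sumrB /= -!mulr_sumr c1 -/S1 -/S2; ring.
by rewrite -/S1; field.
Qed.

Lemma isom_barycenter m r (c : 'I_r -> R) (x : 'I_r -> 'rV[R]_m) (g : eisometry R m) :
  \sum_i c i = 1 -> g (\sum_i c i *: x i) = \sum_i c i *: g (x i).
Proof.
move=> c1; apply: sqdist_eq0; set p := \sum_i c i *: x i.
rewrite sqdist_barycenter // -[RHS](sqdistxx p) {3}/p sqdist_barycenter //.
congr (_ - _ * _); first by apply: eq_bigr => i _; rewrite sqdist_isom.
by apply: eq_bigr => i _; apply: eq_bigr => j _; rewrite sqdist_isom.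
Qed.

Lemma isom_segment m (a b : 'rV[R]_m) t (g : eisometry R m) :
  g (a + t *: (b - a)) = g a + t *: (g b - g a).
Proof.
have E (u v : 'rV[R]_m) : u + t *: (v - u) =
    \sum_(i < 2) [:: 1 - t; t]`_i *: (nth 0 [:: u; v] i).
  by rewrite !big_ord_recl big_ord0 /= addr0 scalerBl scale1r scalerBr addrA addrAC.
rewrite !E isom_barycenter; first by rewrite !big_ord_recl !big_ord0.
by rewrite !big_ord_recl big_ord0 /=; ring.
Qed.

Lemma gram_eq0 m n (B : 'M[R]_(m, n)) : B *m B^T = 0 -> B = 0.
Proof.
move=> e; apply/matrixP => i j; rewrite mxE.
have /eqP : (B *m B^T) i i = 0 by rewrite e mxE.
rewrite mxE psumr_eq0 => [/allP/(_ j)|k _]; last by rewrite mxE -expr2 sqr_ge0.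
by rewrite mem_index_enum mxE -expr2 sqrf_eq0 => /(_ isT)/eqP.
Qed.

(** The normal equations [u (A A^T) = v A^T] have a solution since [A A^T] has the
    same rank as [A]: a vector of the kernel of [A A^T] has an image under [A] of
    norm zero. *)
Lemma orthogonal_decomposition r d (A : 'M[R]_(r, d)) (v : 'rV[R]_d) :
  exists u : 'rV[R]_r, (v - u *m A) *m A^T = 0.
Proof.
suff /submxP[u Hu] : (v *m A^T <= A *m A^T)%MS.
  by exists u; rewrite mulmxBl Hu mulmxA subrr.
apply: submx_trans (submxMl v A^T) _.
rewrite -(geq_leqif (mxrank_leqif_sup (submxMl A A^T))) mxrank_tr.
have : (\rank (kermx (A *m A^T)) <= \rank (kermx A))%N.
  apply: mxrankS; apply/sub_kermxP; apply: gram_eq0.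
  by rewrite trmx_mul mulmxA -(mulmxA (kermx _)) mulmx_ker mul0mx.
by rewrite !mxrank_ker leq_sub2lE ?rank_leq_row.

Qed.

Lemma sqdistE m (x y : 'rV[R]_m) : sqdist x y = ((x - y) *m (x - y)^T) 0 0.
Proof. by rewrite mxE; apply: eq_bigr => i _; rewrite !mxE expr2. Qed.

(** The foot of the perpendicular from [z] to the affine hull of the [x i], given
    by its barycentric coordinates; [eta] is the squared length of the
    perpendicular. *)
Lemma affine_projection r d (x : 'I_r.+1 -> 'rV[R]_d) (z : 'rV[R]_d) :
  exists (c : 'I_r.+1 -> R) (eta : R), [/\ \sum_i c i = 1, 0 <= eta &
    forall i, sqdist (x i) z = sqdist (x i) (\sum_j c j *: x j) + eta].
Proof.
pose A : 'M[R]_(r.+1, d) := \matrix_i (x i - x 0).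
have [u Hu] := orthogonal_decomposition A (z - x 0).
set w := _ - _ in Hu.
(* The foot is [x 0 + u A], that is, the combination of the [x i - x 0] with
   coefficients [u]; the missing weight goes to [x 0]. *)
pose c i := u 0 i + (i == 0)%:R * (1 - \sum_j u 0 j).
exists c, (sqdist w 0).
have c1 : \sum_i c i = 1.
  rewrite big_split /= [X in _ + X](bigD1 0) //= [X in _ + (_ + X)]big1 => [|i /negPf->].
    by rewrite mul1r addr0 addrC subrK.
  by rewrite mul0r.
have cE : \sum_j c j *: x j = x 0 + u *m A.
  rewrite mulmx_sum_row (eq_bigr (fun j => u 0 j *: (x j - x 0) + c j *: x 0)).
    rewrite big_split /= -scaler_suml c1 scale1r addrC; congr (_ + _).
    by apply: eq_bigr => j _; rewrite rowK.
  move=> j _; rewrite scalerBr /c; have [->|nj] := eqVneq j 0; last first.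
    by rewrite mul0r addr0 subrK.
  by rewrite subrr add0r.
split=> [//||i]; first exact: sqdist_ge0.
rewrite sqdistC [in RHS]sqdistC cE !sqdistE subr0.
have -> : z - x i = w + (u - delta_mx 0 i) *m A.
  rewrite mulmxBl -rowE rowK /w addrA subrK; apply/rowP => k; rewrite !mxE; ring.
have -> : x 0 + u *m A - x i = (u - delta_mx 0 i) *m A.
  rewrite mulmxBl -rowE rowK; apply/rowP => k; rewrite !mxE; ring.
set b := u - _; rewrite linearD /= mulmxDl !mulmxDr.
have wb : w *m (b *m A)^T = 0 by rewrite trmx_mul mulmxA Hu mul0mx.
rewrite wb -[_ *m A *m w^T]trmxK trmx_mul trmxK wb trmx0 addr0 add0r.
by rewrite [in LHS]mxE addrC.
Qed.

End Euclid.

(** * Wreath products acting on tuples of points *)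

Section Groups.
Local Open Scope classical_set_scope.
Local Open Scope ring_scope.
Variable R : realType.

Definition finite_orbit m (H : set (eisometry R m)) (q : 'rV[R]_m) :=
  finite_set [set (g : eisometry R m) q | g in H].

Record transitive_action m (H : set (eisometry R m)) (W : set 'rV[R]_m) : Prop :=
  TransitiveAction {
    ta_finite : finite_set W;
    ta_subgroup : is_subgroup H;
    ta_sym : H `<=` symmetry_group W;
    ta_trans : acts_transitively H W }.

Lemma sub_symmetry_group m (H : set (eisometry R m)) (W : set 'rV[R]_m) :
    is_subgroup H -> (forall g x, H g -> W x -> W (g x)) ->
  H `<=` symmetry_group W.
Proof.
move=> /is_subgroupP[_ _ HV] HW g Hg; apply/seteqP; split=> [_ [x Wx <-]|x Wx].
  exact: HW.
exists ((g^-1)%g x); first by apply: HW => //; exact: HV.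
exact: isom_invK.
Qed.

Lemma symmetry_group_subgroup m (W : set 'rV[R]_m) : is_subgroup (symmetry_group W).
Proof.
apply/is_subgroupP; split=> [|g h gW hW|g gW]; rewrite /symmetry_group /=.
- by apply/seteqP; split=> [_ [x Wx <-]|x Wx] //; exists x.
- apply/seteqP; split=> [_ [x Wx <-]|x Wx].
    rewrite -gW; exists (h x) => //; rewrite -hW; by exists x.
  move: Wx; rewrite -{1}gW => -[y Wy <-]; move: Wy; rewrite -{1}hW => -[u Wu <-].
  by exists u.
apply/seteqP; split=> [_ [x Wx <-]|x Wx].
  by move: Wx; rewrite -{1}gW => -[y Wy <-]; rewrite [X in W X]isom_funK.
by exists (g x); [rewrite -gW; exists x|exact: isom_funK].
Qed.

(** The symmetry group of a set that does not span the space is infinite, and so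
    may be the orbit of a point outside the affine hull of the set. *)
Lemma finite_orbit_barycenter m r (H : set (eisometry R m)) (W : set 'rV[R]_m)
    (c : 'I_r -> R) (x : 'I_r -> 'rV[R]_m) :
    transitive_action H W -> \sum_i c i = 1 -> (forall i, W (x i)) ->
  finite_orbit H (\sum_i c i *: x i).
Proof.
move=> [/finite_seqP[s Ws] _ HW _] c1 Wx.
pose F (phi : {ffun 'I_r -> seq_sub s}) := \sum_i c i *: val (phi i).
apply: (@sub_finite_set _ _ (range F)); last exact/finite_image/finite_finset.
move=> _ [g Hg <-].
have gs i : g (x i) \in s.
  have : W (g (x i)) by rewrite -(HW g Hg); exists (x i).
  by rewrite Ws.
exists [ffun i => SeqSub (gs i)] => //.
by rewrite isom_barycenter //; apply: eq_bigr => i _; rewrite ffunE.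
Qed.

Lemma finite_orbit_segment m (H : set (eisometry R m)) a b t :
  finite_orbit H a -> finite_orbit H b -> finite_orbit H (a + t *: (b - a)).
Proof.
move=> fa fb.
apply: sub_finite_set (finite_image2 (fun u v => u + t *: (v - u)) fa fb).
move=> _ [g Hg <-]; rewrite isom_segment.
by exists (g a); [exists g|exists (g b); first by exists g].
Qed.

Section Lift.
Variable m : nat.
Implicit Type g : eisometry R m.

Definition lift_fun (g : 'rV[R]_m -> 'rV[R]_m) (v : 'rV[R]_(m + 1)) : 'rV[R]_(m + 1) :=
  row_mx (g (lsubmx v)) (rsubmx v).

Lemma lift_funK f f' : cancel f f' -> cancel (lift_fun f) (lift_fun f').
Proof. by move=> fK v; rewrite /lift_fun row_mxKl row_mxKr fK hsubmxK. Qed.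

Lemma lift_dist g x y : edist (lift_fun g x) (lift_fun g y) = edist x y.
Proof.
by apply/edistE; rewrite sqdist_row_mx sqdist_isom -sqdist_row_mx !hsubmxK.
Qed.

Definition lift_isom g : eisometry R (m + 1) :=
  EIsometry (lift_funK (isom_funK g)) (lift_funK (@isom_invK _ _ g)) (lift_dist g).

Lemma lift_isom1 : lift_isom 1%g = 1%g.
Proof. by apply: isometryP => v; rewrite /= /lift_fun hsubmxK. Qed.

Lemma lift_isomM g h : lift_isom (g * h)%g = (lift_isom g * lift_isom h)%g.
Proof. by apply: isometryP => v; rewrite /= /lift_fun row_mxKl row_mxKr. Qed.

Lemma lift_isomV g : lift_isom g^-1%g = (lift_isom g)^-1%g.
Proof. exact: isometryP. Qed.

Lemma lift_subgroup (H : set (eisometry R m)) :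
  is_subgroup H -> is_subgroup (lift_isom @` H).
Proof.
move=> /is_subgroupP[H1 HM HV]; apply/is_subgroupP; split.
- by exists 1%g => //; exact: lift_isom1.
- move=> _ _ [g Hg <-] [h Hh <-]; exists (g * h)%g; first exact: HM.
  exact: lift_isomM.
- by move=> _ [g Hg <-]; exists g^-1%g; [exact: HV|exact: lift_isomV].
Qed.

Lemma lift_soluble (H : set (eisometry R m)) :
  is_subgroup H -> soluble H -> soluble (lift_isom @` H).
Proof.
move=> sH; pose rho (k : eisometry R (m + 1)) (h : unit -> eisometry R m) :=
  k = lift_isom (h tt).
apply: (@soluble_transfer _ _ _ rho); rewrite /rho.
- by rewrite lift_isom1.
- by move=> k k' h h' -> ->; rewrite lift_isomM.
- by move=> k h ->; rewrite lift_isomV.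
- by move=> k ->; exact: lift_isom1.
- exact: lift_subgroup.
- by move=> _ [h Hh <-]; exists (fun=> h).
Qed.

Lemma lift_finite_orbit (H : set (eisometry R m)) q b :
  finite_orbit H q -> finite_orbit (lift_isom @` H) (row_mx q b).
Proof.
move=> fq; apply: sub_finite_set (finite_image (row_mx^~ b) fq).
move=> _ [_ [g Hg <-] <-]; exists (g q); first by exists g.
by rewrite /= /lift_fun row_mxKl row_mxKr.
Qed.

End Lift.

Section Wreath.
Variables (M n : nat).
Local Notation E := (eisometry R (n.+1 * M)).
Local Notation rowv i v := (row i (vec_mx v)).

(** A tuple of [n.+1] points is stored as a row vector of length [n.+1 * M], its
    entries being the rows of the corresponding matrix.  Indices are added
    modulo [n.+1], so [s] is the amount of the rotation. *)
Definition wreathed (s : 'I_n.+1) (F : E) (g : 'I_n.+1 -> eisometry R M) :=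
  forall v i, rowv i (F v) = g i (rowv (i + s) v).

Definition wreath_fun (s : 'I_n.+1) (g : 'I_n.+1 -> 'rV[R]_M -> 'rV[R]_M)
    (v : 'rV[R]_(n.+1 * M)) : 'rV[R]_(n.+1 * M) :=
  mxvec (\matrix_i g i (rowv (i + s) v)).

Lemma row_inj (v w : 'rV[R]_(n.+1 * M)) : (forall i, rowv i v = rowv i w) -> v = w.
Proof. by move=> e; rewrite -[v]vec_mxK -[w]vec_mxK; congr mxvec; apply/row_matrixP. Qed.

Lemma row_wreath_fun s g v i : rowv i (wreath_fun s g v) = g i (rowv (i + s) v).
Proof. by rewrite mxvecK rowK. Qed.

Lemma wreath_funK s g h : (forall i, cancel (g i) (h i)) ->
  cancel (wreath_fun s g) (wreath_fun (- s) (fun i => h (i - s))).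
Proof.
move=> gK v; apply: row_inj => i.
by rewrite !row_wreath_fun gK subrK.
Qed.

Lemma wreath_funVK s g h : (forall i, cancel (h i) (g i)) ->
  cancel (wreath_fun (- s) (fun i => h (i - s))) (wreath_fun s g).
Proof.
move=> hK v; apply: row_inj => i.
by rewrite !row_wreath_fun addrK hK.
Qed.

Lemma wreath_dist s (g : 'I_n.+1 -> eisometry R M) v w :
  edist (wreath_fun s g v) (wreath_fun s g w) = edist v w.
Proof.
apply/edistE; rewrite -[v in RHS]vec_mxK -[w in RHS]vec_mxK !sqdist_mxvec.
rewrite [RHS](reindex_inj (addIr s)); apply: eq_bigr => i _.
by rewrite !rowK sqdist_isom.
Qed.

Definition wreath_isom s (g : 'I_n.+1 -> eisometry R M) : E :=
  EIsometry (wreath_funK s (fun i => isom_funK (g i)))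
    (wreath_funVK s (fun i => @isom_invK _ _ (g i))) (wreath_dist s g).

Lemma wreath_isomP s g : wreathed s (wreath_isom s g) g.
Proof. by move=> v i; rewrite row_wreath_fun. Qed.

Lemma wreathed1 : wreathed 0 1%g (fun=> 1%g).
Proof. by move=> v i; rewrite addr0. Qed.

Lemma wreathedM s t F G g h : wreathed s F g -> wreathed t G h ->
  wreathed (s + t) (F * G)%g (fun i => g i * h (i + s))%g.
Proof. by move=> Fg Gh v i; rewrite [LHS]Fg Gh addrA. Qed.

Lemma wreathedV s F g : wreathed s F g ->
  wreathed (- s) F^-1%g (fun i => (g (i - s))^-1)%g.
Proof.
move=> Fg v i; apply: (can_inj (isom_funK (g (i - s)))).
by rewrite [RHS]isom_invK -[v in RHS](isom_invK F) Fg subrK.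
Qed.

Definition wreath_group (K : set (eisometry R M)) : set E :=
  [set F | exists s, exists2 g, (forall i, K (g i)) & wreathed s F g].

Lemma wreath_group_subgroup K : is_subgroup K -> is_subgroup (wreath_group K).
Proof.
move=> /is_subgroupP[K1 KM KV]; apply/is_subgroupP; split.
- by exists 0, (fun=> 1%g) => //; exact: wreathed1.
- move=> F G [s [g Kg Fg]] [t [h Kh Gh]]; exists (s + t).
  exists (fun i => g i * h (i + s))%g; last exact: wreathedM.
  by move=> i; apply: KM.
- move=> F [s [g Kg Fg]]; exists (- s), (fun i => (g (i - s))^-1)%g.
    by move=> i; apply: KV.
  exact: wreathedV.
Qed.

(** Rotations commute, so the derived subgroup of the wreath product rotates by
    zero: it consists of tuples of elements of [K]. *)
Lemma wreath_group_soluble K : is_subgroup K -> soluble K -> soluble (wreath_group K).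
Proof.
move=> sK solK; suff [N HN] : soluble (derived_subgroup (wreath_group K)).
  by exists N.+1; rewrite iterSr.
have [K1 KM KV] := (is_subgroupP _).1 sK.
have mul F G g h : wreathed 0 F g -> wreathed 0 G h ->
    wreathed 0 (F * G)%g (fun i => g i * h i)%g.
  by move=> Fg Gh v i; rewrite (wreathedM Fg Gh) /= !addr0.
have inv F g : wreathed 0 F g -> wreathed 0 F^-1%g (fun i => (g i)^-1)%g.
  by move=> Fg v i; rewrite (wreathedV Fg) oppr0 /= !addr0.
apply: (soluble_transfer wreathed1 mul inv _ (derived_is_subgroup _) _ solK).
  by move=> F F1; apply: isometryP => v; apply: row_inj => i; rewrite F1 addr0.
pose B := [set F | exists2 g, wreathed 0 F g & forall i, K (g i)].
suff : derived_subgroup (wreath_group K) `<=` B by [].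
apply: smallest_sub.
  apply/is_subgroupP; split.
  - by exists (fun=> 1%g); [exact: wreathed1|].
  - move=> F G [g Fg Kg] [h Gh Kh]; exists (fun i => g i * h i)%g; first exact: mul.
    by move=> i; apply: KM.
  - move=> F [g Fg Kg]; exists (fun i => (g i)^-1)%g; first exact: inv.
    by move=> i; apply: KV.
move=> _ [F [s [g Kg Fg]] [G [t [h Kh Gh]] <-]].
have := wreathedM (wreathedV Fg) (wreathedM (wreathedV Gh) (wreathedM Fg Gh)).
have -> : - s + (- t + (s + t)) = 0 :> 'I_n.+1.
  by rewrite addrCA addKr addNr.
move=> FG; eexists; first exact: FG.
by move=> i; do !apply: (KM) => //; apply: (KV).
Qed.

Variables (K : set (eisometry R M)) (q : 'I_n.+1 -> 'rV[R]_M).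

Definition wreath_orbit : set 'rV[R]_(n.+1 * M) :=
  [set v | exists s, exists2 g : 'I_n.+1 -> eisometry R M,
     (forall i, K (g i)) & forall i, rowv i v = g i (q (i + s))].

Lemma wreath_orbit_finite : (forall i, finite_orbit K (q i)) -> finite_set wreath_orbit.
Proof.
move=> fq.
have /finite_seqP[l Ol] : finite_set (\bigcup_(i in [set: 'I_n.+1])
    [set (g : eisometry R M) (q i) | g in K]).
  by apply: bigcup_finite => // i _; exact: fq.
pose F (phi : {ffun 'I_n.+1 -> seq_sub l}) := mxvec (\matrix_i val (phi i)).
apply: (@sub_finite_set _ _ (range F)); last exact/finite_image/finite_finset.
move=> v [s [g Kg vE]].
have gl i : g i (q (i + s)) \in l.
  suff : [set` l] (g i (q (i + s))) by [].
  by rewrite -Ol; exists (i + s) => //; exists (g i).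
exists [ffun i => SeqSub (gl i)] => //.
by apply: row_inj => i; rewrite mxvecK rowK ffunE vE.
Qed.

Lemma wreath_action : is_subgroup K -> (forall i, finite_orbit K (q i)) ->
  transitive_action (wreath_group K) wreath_orbit.
Proof.
move=> sK fq; have [K1 KM KV] := (is_subgroupP _).1 sK.
split; first exact: wreath_orbit_finite.
- exact: wreath_group_subgroup.
- apply: sub_symmetry_group; first exact: wreath_group_subgroup.
  move=> F v [s [g Kg Fg]] [t [h Kh vE]].
  exists (s + t), (fun i => g i * h (i + s))%g; first by move=> i; apply: KM.
  by move=> i; rewrite Fg vE addrA.
move=> v w [s [g Kg vE]] [t [h Kh wE]].
pose f i := (h i * (g (i + (t - s)))^-1)%g.
exists (wreath_isom (t - s) f).
  exists (t - s), f; last exact: wreath_isomP.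
  by move=> i; apply: KM => //; apply: KV.
apply: row_inj => i; rewrite wreath_isomP vE wE /=.
by rewrite isom_funK -addrA subrK.
Qed.

End Wreath.

End Groups.

(** * Pyramids *)

Section Pyramid.
Local Open Scope classical_set_scope.
Local Open Scope ring_scope.
Variable R : realType.

(** The left-hand side is the sum of [n] squared steps [L / n^2 + tau^2] and of the
    squared gap [(n tau)^2] in the extra coordinate between the two ends of the
    walk.  For [n] large the first term is at most [h], and [tau] makes up for
    the difference. *)
Lemma path_parameters (L h : R) : 0 <= L -> 0 < h ->
  exists (n : nat) (tau : R), (0 < n)%N /\
    L / n%:R + (n%:R ^+ 2 + n%:R) * tau ^+ 2 = h.
Proof.
move=> L0 h0; pose n := (Num.bound (L / h)).+1.
have n0 : 0 < n%:R :> R by rewrite ltr0n.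
have Ln : L / n%:R <= h.
  have Lh : L / h < n%:R.
    apply: (@lt_trans _ _ (Num.bound (L / h))%:R); last by rewrite ltr_nat.
    by apply: archi_boundP; rewrite divr_ge0 // ltW.
  by rewrite ler_pdivrMr // mulrC -ler_pdivrMr // ltW.
exists n, (Num.sqrt ((h - L / n%:R) / (n%:R ^+ 2 + n%:R))); split=> //.
have d0 : 0 < n%:R ^+ 2 + n%:R :> R by rewrite addr_gt0 ?exprn_gt0.
rewrite sqr_sqrtr ?divr_ge0 ?subr_ge0 // ?(ltW d0) //.
by rewrite [_ * (_ / _)]mulrC divfK ?gt_eqF // addrC subrK.
Qed.

(** [h] is the square of the height of the apex above [p].  The tuple [phi x]
    replaces by [x] the first entry [x0] of the walk from [x0] to [p], and the
    apex is the walk rotated by one place. *)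
Lemma pyramid_in_orbit m (H : set (eisometry R m)) (W : set 'rV[R]_m) x0 p (h : R) :
    transitive_action H W -> W x0 -> finite_orbit H p -> 0 < h ->
  exists (M : nat) (W' : set 'rV[R]_M) (H' : set (eisometry R M))
    (phi : 'rV[R]_m -> 'rV[R]_M) (apex : 'rV[R]_M),
  [/\ transitive_action H' W' /\ (soluble H -> soluble H'),
      forall x, W x -> W' (phi x), W' apex,
      forall x y, sqdist (phi x) (phi y) = sqdist x y &
      forall x, sqdist (phi x) apex = sqdist x p + h].
Proof.
move=> actH Wx0 fp h0.
have [fW sH HW trH] := actH; have [H1 HM HV] := (is_subgroupP _).1 sH.
have [n [tau [n0 hE]]] := path_parameters (sqdist_ge0 p x0) h0.
have nR : n%:R != 0 :> R by rewrite pnatr_eq0 -lt0n.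
pose q (i : nat) : 'rV[R]_(m + 1) :=
  row_mx (x0 + (i%:R / n%:R) *: (p - x0)) (const_mx (i%:R * tau)).
pose K := @lift_isom R m @` H.
have sK : is_subgroup K by exact: lift_subgroup.
have fx0 : finite_orbit H x0.
  apply: sub_finite_set fW => _ [g Hg <-]; rewrite -(HW g Hg); by exists x0.
have fq (i : 'I_n.+1) : finite_orbit K (q i).
  by apply: lift_finite_orbit; apply: finite_orbit_segment.
have act := wreath_action sK fq.
pose base x : 'rV[R]_(m + 1) := row_mx x (const_mx 0).
pose phi x := mxvec (\matrix_(i < n.+1) if i == ord0 then base x else q i).
(* Adding [ord_max] modulo [n.+1] amounts to subtracting one. *)
pose apex := mxvec (\matrix_(i < n.+1) q (i + ord_max)).
have q0 : q 0%N = base x0 by rewrite /q mul0r scale0r addr0 mul0r.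
have qn : q n = row_mx p (const_mx (n%:R * tau)).
  by rewrite /q divff // scale1r addrC subrK.
have K1 : K 1%g by exists 1%g => //; exact: lift_isom1.
exists (n.+1 * (m + 1))%N, (wreath_orbit K (fun i : 'I_n.+1 => q i)),
  (wreath_group K), phi, apex; split.
- by split=> // /(lift_soluble sH)/(wreath_group_soluble _ sK).
- move=> x Wx; have [g Hg gx] := trH _ _ Wx0 Wx.
  exists 0, (fun i => if i == ord0 then lift_isom g else 1%g).
    by move=> i; case: ifP => // _; exists g.
  move=> i; rewrite mxvecK rowK addr0; case: eqVneq => [->|//] /=.
  by rewrite q0 /lift_fun row_mxKl row_mxKr gx.
- exists ord_max, (fun=> 1%g) => // i.
  by rewrite mxvecK rowK.
- move=> x y; rewrite sqdist_mxvec big_ord_recl !rowK eqxx sqdist_row_mx sqdistxx addr0.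
  by rewrite big1 ?addr0 // => i _; rewrite !rowK sqdistxx.
move=> x; rewrite sqdist_mxvec big_ord_recl !rowK eqxx add0r qn sqdist_row_mx -addrA.
congr (_ + _).
have step (i : 'I_n) : sqdist (row (fintype.lift ord0 i)
      (\matrix_(i0 < n.+1) if i0 == ord0 then base x else q i0))
    (row (fintype.lift ord0 i) (\matrix_(i0 < n.+1) q (i0 + ord_max))) =
    sqdist p x0 / n%:R ^+ 2 + tau ^+ 2.
  rewrite !rowK /=.
  have -> : ((bump 0 i + n) %% n.+1 = i)%N.
    by rewrite /bump add1n addSnnS modnDr modn_small // ltnW // ltnS.
  rewrite sqdist_row_mx; congr (_ + _).
    rewrite /sqdist mulr_suml; apply: eq_bigr => k _; rewrite !mxE /bump add1n -natr1.
    by field.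
  by rewrite /sqdist big_ord1 !mxE /bump add1n -natr1; ring.
rewrite (eq_bigr _ (fun i _ => step i)) sumr_const card_ord -hE.
rewrite /sqdist big_ord1 !mxE -mulr_natr; field.
exact: nR.
Qed.

(** The foot of the perpendicular is transported to the copy [f @` X] by means of
    its barycentric coordinates; [sqdist_barycenter] shows that its distances to
    the points of [X] are preserved. *)
Lemma pyramid_embedding d m (X : set 'rV[R]_d) (z : 'rV[R]_(d + 1))
    (f : 'rV[R]_d -> 'rV[R]_m) (W : set 'rV[R]_m) (H : set (eisometry R m)) :
    transitive_action H W -> finite_set X -> X !=set0 ->
    (forall x y, X x -> X y -> edist (f x) (f y) = edist x y) -> f @` X `<=` W ->
    ~ base_hyperplane z ->
  exists (M : nat) (W' Y : set 'rV[R]_M) (H' : set (eisometry R M)),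
  [/\ transitive_action H' W', soluble H -> soluble H',
      congruent (pyramid X z) Y & Y `<=` W'].
Proof.
move=> actH /finite_seqP[s Xs] [x0 Xx0] fX fXW zX.
have x0s : x0 \in s by move: Xx0; rewrite Xs.
case: s Xs x0s => // a s Xs _.
pose x (i : 'I_(size s).+1) := (a :: s)`_i.
have Xx i : X (x i) by rewrite Xs /= mem_nth.
have XP y : X y -> exists i, y = x i.
  rewrite Xs /= => ys; have lt : (index y (a :: s) < (size s).+1)%N by rewrite index_mem.
  by exists (Ordinal lt); rewrite /x nth_index.
have [c [eta [c1 eta0 proj]]] := affine_projection x (lsubmx z).
pose t := rsubmx z ord0 ord0.
have zE : z = row_mx (lsubmx z) (const_mx t).
  rewrite -[LHS]hsubmxK; congr row_mx; apply/rowP => i.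
  by rewrite [RHS]mxE [i]ord1.
have t0 : t != 0.
  apply/eqP => t0; apply: zX; exists (lsubmx z) => //.
  by rewrite [RHS]zE t0.
pose h := eta + t ^+ 2.
have h0 : 0 < h by rewrite ltr_wpDl // exprn_even_gt0.
pose p := \sum_i c i *: x i; pose p' := \sum_i c i *: f (x i).
have Wfx y : X y -> W (f y) by move=> Xy; apply: fXW; exists y.
have fp' : finite_orbit H p'.
  by apply: (finite_orbit_barycenter actH) => // i; apply: Wfx.
have fXs y y' : X y -> X y' -> sqdist (f y) (f y') = sqdist y y'.
  by move=> Xy Xy'; apply/edistE; apply: fX.
have [M [W' [H' [phi [apex [[act' sol'] Wphi Wapex phiD apexD]]]]]] :=
  pyramid_in_orbit actH (Wfx _ Xx0) fp' h0.
have apexE y : X y -> sqdist (phi (f y)) apex = sqdist (base_embed y) z.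
  move=> Xy; rewrite apexD zE sqdist_row_mx.
  have [i yi] := XP _ Xy; rewrite [in RHS]yi proj -yi /h addrA; congr (_ + _ + _).
    rewrite !sqdist_barycenter //; congr (_ - _ * _).
      by apply: eq_bigr => j _; rewrite fXs.
    by apply: eq_bigr => j _; apply: eq_bigr => k _; rewrite fXs.
  by rewrite /sqdist big_ord1 !mxE sub0r sqrrN.
pose F (w : 'rV[R]_(d + 1)) := if w == z then apex else phi (f (lsubmx w)).
have Fbase y : F (base_embed y) = phi (f y).
  rewrite /F ifF ?row_mxKl //; apply/eqP => yz; apply: zX; by exists y.
have Fz : F z = apex by rewrite /F eqxx.
exists M, W', (F @` pyramid X z), H'; split=> //.
  exists F; split=> // _ _ [[y Xy <-]|->] [[y' Xy' <-]|->]; apply/edistE; rewrite ?Fbase ?Fz.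
  - by rewrite phiD fXs // sqdist_row_mx sqdistxx addr0.
  - exact: apexE.
  - by rewrite sqdistC apexE // sqdistC.
  - by rewrite !sqdistxx.
by move=> _ [_ [[y Xy <-]|->] <-]; rewrite ?Fbase ?Fz //; apply/Wphi/Wfx.
Qed.

Lemma soluble_set1 d (z : 'rV[R]_d) : soluble_set [set z].
Proof.
split; first exact: finite_set1.
exists [set 1%g]; split.
- apply/is_subgroupP; split=> [//|_ _ -> ->|_ ->]; first by rewrite /= mulg1.
  by rewrite /= invg1.
- by move=> _ ->; rewrite /symmetry_group /= image_set1.
- by exists 0%N.
by move=> _ _ -> ->; exists 1%g.
Qed.

Lemma transitive_actionW m (H : set (eisometry R m)) (W : set 'rV[R]_m) :
  transitive_action H W -> transitive_set W.
Proof.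
move=> [fW _ HW trH]; split=> // x y Wx Wy.
by have [g /HW gW gx] := trH _ _ Wx Wy; exists g.
Qed.

Lemma soluble_transitive m (W : set 'rV[R]_m) : soluble_set W -> transitive_set W.
Proof.
by move=> [fW [H [sH HW _ trH]]]; exact: transitive_actionW (TransitiveAction fW sH HW trH).
Qed.

Lemma congruent_id d (X : set 'rV[R]_d) : congruent X X.
Proof. by exists id; rewrite image_id. Qed.

Lemma subsoluble_ramsey d (X : set 'rV[R]_d) : subsoluble X -> ramsey X.
Proof.
move=> [m [W [Y [sW [f [fX fY]] YW]]]].
by apply: soluble_ramsey sW fX _; rewrite fY.
Qed.

End Pyramid.

Theorem corollary4 (R : realType) (d : nat) (X : set 'rV[R]_d)
    (z : 'rV[R]_(d + 1)) (hX : transitive_set X)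
    (hz : ~ base_hyperplane z) :
  subtransitive (pyramid X z) /\
  (subsoluble X -> subsoluble (pyramid X z) /\ ramsey (pyramid X z)).
Proof.
have [fX trX] := hX.
(* An empty base has no affine hull to project on, but then the pyramid is a
   single point. *)
have [X0|nX0] := eqVneq X set0.
  have sol : subsoluble (pyramid X z).
    exists (d + 1)%N, [set z]%classic, [set z]%classic; split=> //; first exact: soluble_set1.
    by rewrite /pyramid X0 image_set0 set0U; exact: congruent_id.
  split; last by move=> _; split=> //; exact: subsoluble_ramsey.
  have [m [W [Y [sW XY YW]]]] := sol; exists m, W, Y; split=> //.
  exact: soluble_transitive.
move/set0P in nX0; split.
  have act : transitive_action (symmetry_group X) X.
    by split=> //; exact: symmetry_group_subgroup.
  have [||M [W [Y [H [actH _ XY YW]]]]] := pyramid_embedding (f := id) act fX nX0 _ _ hz.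
  - by [].
  - by rewrite image_id.
  by exists M, W, Y; split=> //; exact: transitive_actionW actH.
move=> [m [W [Y [[fW [H [sH HW solH trH]]] [f [fXD fXY]] YW]]]].
suff sol : subsoluble (pyramid X z) by split=> //; exact: subsoluble_ramsey.
have [|M [W' [Y' [H' [actH sol XY YW']]]]] :=
  pyramid_embedding (TransitiveAction fW sH HW trH) fX nX0 fXD _ hz.
  by rewrite fXY.
exists M, W', Y'; split=> //; have [fW' sH' HW' trH'] := actH.
by split=> //; exists H'; split=> //; exact: sol.
Qed.
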